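(* Consider the system with Hamiltonian $$H=\frac12\Bigl(S_1^2+S_2^2+\frac{S_3^2}\beta\Bigr)+g_1(\mathbf R^2,R_3)(S_1R_2-S_2R_1)+g_2(\mathbf R^2,R_3)\langle\mathbf S,\mathbf R\rangle+g_3(\mathbf R^2,R_3)S_3+V(\mathbf R^2,R_3)$$ and integral $K=S_3$ on $\mathrm e(3)^*$. The set of all singular points of rank $1$ (with $\mathbf R\ne0$) is the subset of $U=\{(\mathbf S,\mathbf R): R_1^2+R_2^2\neq0\}$ given by the following two equations in the coordinates $(x,m,\phi,k,a,g)$: $$m=-(a-x^2)g_1,$$ $$\frac{(kx-g)(ka-gx)}{(a-x^2)^2}+xg_1^2-(a-x^2)g_1\frac{\partial g_1}{\partial x}+g\frac{\partial g_2}{\partial x}+k\frac{\partial g_3}{\partial x}+\frac{\partial V}{\partial x}=0,$$ where $g_1,g_2,g_3,V$ and their derivatives are evaluated at $(a,x)$.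
   Context: On $\mathrm e(3)^*=\mathbb R^6$ with linear coordinates $(\mathbf S,\mathbf R)=(S_1,S_2,S_3,R_1,R_2,R_3)$ consider the Lie–Poisson bracket $\{S_i,S_j\}=\varepsilon_{ijk}S_k$, $\{S_i,R_j\}=\varepsilon_{ijk}R_k$, $\{R_i,R_j\}=0$. For a smooth function $f$, $\mathrm{sgrad} f$ is the Hamiltonian vector field $\dot x_i=\{x_i,f\}$. The Casimir functions are $\langle\mathbf R,\mathbf R\rangle=\mathbf R^2$ and $\langle\mathbf S,\mathbf R\rangle$; the system is considered on the orbits $M^4_{a,g}=\{\langle\mathbf R,\mathbf R\rangle=a,\ \langle\mathbf S,\mathbf R\rangle=g\}$ with $a>0$. In the Hamiltonian, $\beta>0$ is a constant and $g_1,g_2,g_3,V$ are smooth functions of two variables $(a,x)$ (the values of $\mathbf R^2$ and $R_3$) in the range $a>0$; $\partial/\partial x$ is the derivative with respect to the second argument. A point is a singular point of rank $1$ if the span of $\mathrm{sgrad} H,\mathrm{sgrad} K$ at it is one-dimensional. Coordinates $(x,m,\phi,k,a,g)$ on $U$ (with $x^2<a$, $\phi$ defined modulo $2\pi$): $x=R_3$, $m=S_1R_2-S_2R_1$, $\phi=\arg(R_1+iR_2)$, $k=S_3$, $a=\langle\mathbf R,\mathbf R\rangle$, $g=\langle\mathbf S,\mathbf R\rangle$. *)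

(* Defs.v *)
From HB Require Import structures.
From mathcomp Require Import all_boot all_order all_algebra.
From mathcomp Require Import all_classical all_reals all_analysis.

Set Implicit Arguments.
Unset Strict Implicit.
Unset Printing Implicit Defensive.

Import Order.TTheory GRing.Theory Num.Theory.
Import numFieldNormedType.Exports.

Local Open Scope classical_set_scope.
Local Open Scope ring_scope.

(* Meant for D open in a finite-dimensional W, where these are the usual C^k
   and C^oo classes on D; the values of f outside of D are irrelevant. *)
Fixpoint Ck_on (R : realType) (W : normedModType R) (D : set W) (k : nat)
    (f : W -> R) : Prop :=
  match k with
  | 0%N => forall p, D p -> {for p, continuous f}
  | k'.+1 => (forall p, D p -> differentiable f p) /\
             (forall v : W, Ck_on D k' ('D_v f))
  end.

Definition smooth_on (R : realType) (W : normedModType R) (D : set W)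
    (f : W -> R) : Prop := forall k : nat, Ck_on D k f.

(* A coefficient (a, x) |-> f a x is constrained only in the range a > 0. *)
Definition smooth_coef (R : realType) (f : R -> R -> R) : Prop :=
  smooth_on [set q : R * R | 0 < q.1] (fun q => f q.1 q.2).

Definition dsnd (R : realType) (f : R -> R -> R) (a x : R) : R :=
  derive1 (f a) x.

(* Points of e(3)^* = R^6 are row vectors (S_1, S_2, S_3, R_1, R_2, R_3). *)
Notation e3dual R := 'rV[R]_(3 + 3).

Section E3.
Variable R : realType.
Implicit Types (p : e3dual R) (f h H K : e3dual R -> R).

Definition Svec p : 'rV[R]_3 := lsubmx p.
Definition Rvec p : 'rV[R]_3 := rsubmx p.

(* Indices in 'I_3 start from 0. *)
Definition S1 p : R := Svec p 0 0.
Definition S2 p : R := Svec p 0 1.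
Definition S3 p : R := Svec p 0 2.
Definition R1 p : R := Rvec p 0 0.
Definition R2 p : R := Rvec p 0 1.
Definition R3 p : R := Rvec p 0 2.

Definition dot (u v : 'rV[R]_3) : R := \sum_(i < 3) u 0 i * v 0 i.

(* Levi-Civita symbol; the additions are modulo 3 in 'I_3. *)
Definition levi_civita (i j k : 'I_3) : R :=
  ((j == i + 1) && (k == j + 1))%:R - ((k == i + 1) && (j == k + 1))%:R.

(* The matrix of the brackets {x_i, x_j} of the linear coordinates; the lower
   left block is {R_i, S_j} = - {S_j, R_i}. *)
Definition poisson_mx p : 'M[R]_(3 + 3) :=
  let SS := \matrix_(i < 3, j < 3) \sum_(k < 3) levi_civita i j k * Svec p 0 k in
  let SR := \matrix_(i < 3, j < 3) \sum_(k < 3) levi_civita i j k * Rvec p 0 k in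
  block_mx SS SR (- SR^T) 0.

Definition partial (i : 'I_(3 + 3)) f p : R := 'D_(delta_mx 0 i) f p.

Definition poisson f h p : R :=
  \sum_(i < 3 + 3) \sum_(j < 3 + 3)
    poisson_mx p i j * partial i f p * partial j h p.

Definition sgrad f p : e3dual R :=
  \row_(i < 3 + 3) poisson (fun q => q 0 i) f p.

Definition singular_rank1 H K p : Prop :=
  \dim <<[:: sgrad H p; sgrad K p]>>%VS = 1%N.

Definition hamiltonian (beta : R) (g1 g2 g3 V : R -> R -> R) p : R :=
  let a := dot (Rvec p) (Rvec p) in
  2^-1 * (S1 p ^+ 2 + S2 p ^+ 2 + S3 p ^+ 2 / beta)
  + g1 a (R3 p) * (S1 p * R2 p - S2 p * R1 p)
  + g2 a (R3 p) * dot (Svec p) (Rvec p)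
  + g3 a (R3 p) * S3 p
  + V a (R3 p).

Definition integralK p : R := S3 p.

Definition Udom : set (e3dual R) :=
  [set p | R1 p ^+ 2 + R2 p ^+ 2 != 0].

(* The coordinates of a point of Udom, apart from phi = arg (R1 + i R2). *)
Definition coord_x p : R := R3 p.
Definition coord_m p : R := S1 p * R2 p - S2 p * R1 p.
Definition coord_k p : R := S3 p.
Definition coord_a p : R := dot (Rvec p) (Rvec p).
Definition coord_g p : R := dot (Svec p) (Rvec p).

End E3.

(* Main.v *)
(** Write [gS], [gR] for the [S]- and [R]-gradients of [f]. Then
    [sgrad f = (gS x S + gR x R, gS x R)], and for [K = S_3] this is the
    rotation [(e3 x S, e3 x R)], which does not vanish on [U]; so on [U] rank one means
    [sgrad H = c sgrad K] for some [c]. With [lambda := (g - k x) / (a - x^2)],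
    the [R]-components give [m = - (a - x^2) g_1] together with the value
    [c = H_{S_3} - x (lambda + g_2)], and what is left of the [S]-components is
    the single equation
    [x lambda^2 - k lambda + x g_1^2 + dH/dx = 0], where [dH/dx] is the
    derivative through the second argument of the coefficients; this is the
    second equation. Off [U], where [R_1 = R_2 = 0 <> R_3], collinearity forces
    [S_1 = S_2 = 0], and there both fields vanish. *)
Require Import Defs.
From HB Require Import structures.
From mathcomp Require Import all_boot all_order all_algebra.
From mathcomp Require Import all_classical all_reals all_analysis.
From mathcomp Require Import ring lra.
Import Order.TTheory GRing.Theory Num.Theory.
Import numFieldNormedType.Exports.
Local Open Scope classical_set_scope.
Local Open Scope ring_scope.

(** * Linear algebra: spans of two vectors, cross products *)

Lemma dim_span2_eq1 {K : fieldType} {vT : vectType K} {u w : vT} :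
  w != 0 -> \dim <<[:: u; w]>>%VS = 1%N <-> exists c, u = c *: w.
Proof.
move=> w_neq0; have dimw : \dim <[w]>%VS = 1%N by rewrite dim_vline w_neq0.
rewrite span_cons span_seq1; split=> [dim1|[c ->]].
  have /eqP defw : <[w]>%VS == (<[u]> + <[w]>)%VS.
    by rewrite eqEdim addvSr dim1 dimw.
  by apply/vlineP; rewrite defw (subvP (addvSl _ _)) ?memv_line.
have /addv_idPr -> // : (<[c *: w]> <= <[w]>)%VS.
by rewrite -memvE memvZ ?memv_line.
Qed.

Definition vec3 {R : realType} (x y z : R) : 'rV[R]_3 :=
  \row_(i < 3) [:: x; y; z]`_i.

Lemma vec3E {R : realType} (x y z : R) :
  ((vec3 x y z 0 0 = x) * (vec3 x y z 0 1 = y) * (vec3 x y z 0 2 = z))%type.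
Proof. by rewrite !mxE. Qed.

Lemma sum3 {R : nmodType} (F : 'I_3 -> R) : \sum_(i < 3) F i = F 0 + F 1 + F 2.
Proof.
rewrite !big_ord_recl big_ord0 addr0 addrA.
by congr (F _ + F _ + F _); apply/val_inj.
Qed.

Definition crossv {R : realType} (u w : 'rV[R]_3) : 'rV[R]_3 :=
  vec3 (u 0 1 * w 0 2 - u 0 2 * w 0 1)
       (u 0 2 * w 0 0 - u 0 0 * w 0 2)
       (u 0 0 * w 0 1 - u 0 1 * w 0 0).

Lemma ord3P (P : 'I_3 -> Prop) : P 0 -> P 1 -> P 2 -> forall i, P i.
Proof.
move=> P0 P1 P2 [[|[|[|//]]] lti].
- by have -> : Ordinal lti = 0 by apply/val_inj.
- by have -> : Ordinal lti = 1 by apply/val_inj.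
- by have -> : Ordinal lti = 2 by apply/val_inj.
Qed.

Lemma levi_civita_swap {R : realType} i j k :
  levi_civita R j i k = - levi_civita R i j k.
Proof.
by move: i; apply: ord3P; move: j; apply: ord3P; move: k; apply: ord3P;
   rewrite /levi_civita /=; ring.
Qed.

(** The inner sum has the shape of the entries of [poisson_mx], so a row of one of its blocks paired
    with a gradient is a cross product. *)
Lemma crossvE {R : realType} (u w : 'rV[R]_3) i :
  crossv u w 0 i =
  \sum_(j < 3) (\sum_(k < 3) levi_civita R i j k * w 0 k) * u 0 j.
Proof.
by move: i; apply: ord3P; rewrite !mxE !sum3 /levi_civita /=; ring.
Qed.

(** * Differentials of coordinates and coefficients *)

Lemma is_diff_coord {R : realType} {m n} (M : 'M[R]_(m, n)) i j :
  is_diff M (fun N : 'M[R]_(m, n) => N i j) (fun N => N i j).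
Proof.
have linf : linear (fun N : 'M[R]_(m, n) => N i j : R^o).
  by move=> c N N'; rewrite !mxE.
pose fL := GRing.isLinear.Build _ _ _ _ _ linf.
pose f : {linear 'M[R]_(m, n) -> R^o} :=
  HB.pack (fun N : 'M[R]_(m, n) => N i j : R^o) fL.
apply: DiffDef; first exact: differentiable_coord.
exact: (@diff_lin _ _ _ f M (@coord_continuous _ _ _ _ _)).
Qed.

Lemma is_derive_diff {R : realType} {V W : normedModType R} {f df : V -> W}
    {p} v :
  is_diff p f df -> is_derive p v f (df v).
Proof.
move=> fP; have fp : differentiable f p by exact: ex_diff.
by apply: DeriveDef; [exact: diff_derivable|rewrite deriveE// diff_val].
Qed.

Lemma is_diff_Svec {R : realType} (p : e3dual R) i :
  is_diff p (fun q => Svec q 0 i) (fun q => Svec q 0 i).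
Proof.
have -> : (fun q : e3dual R => Svec q 0 i) = (fun q => q 0 (lshift 3 i)).
  by apply/funext => q; rewrite mxE.
exact: is_diff_coord.
Qed.

Lemma is_diff_Rvec {R : realType} (p : e3dual R) i :
  is_diff p (fun q => Rvec q 0 i) (fun q => Rvec q 0 i).
Proof.
have -> : (fun q : e3dual R => Rvec q 0 i) = (fun q => q 0 (rshift 3 i)).
  by apply/funext => q; rewrite mxE.
exact: is_diff_coord.
Qed.

Lemma is_diff_coord_a {R : realType} (p : e3dual R) :
  is_diff p (@coord_a R) (fun v => 2 * dot (Rvec p) (Rvec v)).
Proof.
have -> : @coord_a R =
    \sum_(i < 3) ((fun q => Rvec q 0 i) * (fun q => Rvec q 0 i)).
  by apply/funext => q; rewrite /coord_a /dot fct_sumE.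
have D i := is_diffM (is_diff_Rvec p i) (is_diff_Rvec p i).
rewrite sum3; apply: (is_diff_eq (is_diffD (is_diffD (D 0) (D 1)) (D 2))).
by apply/funext => v; rewrite /dot sum3 !fctE /GRing.scale/=; ring.
Qed.

(** Chain rule through [q |-> (coord_a q, R3 q)]. The derivative [fa] in the first argument stays
    anonymous: it only multiplies the differential of the Casimir [R^2]. *)
Lemma is_diff_coef {R : realType} {f : R -> R -> R} {p : e3dual R} :
  smooth_coef f -> 0 < coord_a p ->
  exists fa, is_diff p (fun q => f (coord_a q) (R3 q))
    (fun v => fa * (2 * dot (Rvec p) (Rvec v))
              + dsnd f (coord_a p) (R3 p) * R3 v).
Proof.
move=> /(_ 1%N)[/= df _] a_gt0; have {df} df := df (coord_a p, R3 p) a_gt0.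
set F := fun q : R * R => f q.1 q.2 in df.
pose dF := 'd F (coord_a p, R3 p).
exists (dF (1, 0)).
have D3 : is_diff (coord_a p, R3 p) F dF by exact: DiffDef.
(* Differentiate [F] along the line [t |-> (coord_a p, t)]. *)
have Dx : dsnd f (coord_a p) (R3 p) = dF (0, 1).
  have D := is_diff_pair (is_diff_cst (coord_a p) (R3 p)) (is_diff_id (R3 p)).
  have DF := is_derive_diff (1 : R) (is_diff_comp D D3).
  by rewrite /dsnd derive1E; exact: derive_val.
rewrite Dx.
have D1 := is_diff_coord_a p; have D2 := is_diff_Rvec p 2.
have := @is_diff_comp _ _ _ _ _ _ _ _ _ (is_diff_pair D1 D2) D3.
move/is_diff_eq; apply; apply/funext => v /=.
set s := 2 * _; set t := Rvec v 0 2.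
have -> : (s, t) = s *: (1, 0) + t *: (0, 1) :> R * R.
  by congr pair; rewrite /= /GRing.scale/= ?mulr1 ?mulr0 ?addr0 ?add0r.
by rewrite linearD !linearZ /=; congr (_ + _); exact: mulrC.
Qed.

(** * Hamiltonian vector fields as cross products *)

(** Here [a] and [b] are the [S]- and [R]-gradients of [f]. A coordinate function has a single
    nonzero partial derivative, so the double sum in [poisson] collapses to one row of
    [poisson_mx]. *)
Lemma sgrad_crossv {R : realType} {f : e3dual R -> R} {p a b} :
  (forall v, is_derive p v f (dot a (Svec v) + dot b (Rvec v))) ->
  sgrad f p =
    row_mx (crossv a (Svec p) + crossv b (Rvec p)) (crossv a (Rvec p)).
Proof.
move=> fP.
have fS i : partial (lshift 3 i) f p = a 0 i.
  rewrite /partial derive_val /dot !sum3 !mxE !eq_rlshift !eq_lshift.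
  by move: i; apply: ord3P => /=; ring.
have fR i : partial (rshift 3 i) f p = b 0 i.
  rewrite /partial derive_val /dot !sum3 !mxE !eq_lrshift !eq_rshift.
  by move: i; apply: ord3P => /=; ring.
have coordE i k : partial i (fun q : e3dual R => q 0 k) p = (k == i)%:R.
  by have /(is_derive_diff (delta_mx 0 i)) D := is_diff_coord p 0 k;
     rewrite /partial derive_val mxE.
have sgradE k : sgrad f p 0 k = \sum_j poisson_mx p k j * partial j f p.
  rewrite mxE /poisson (bigD1 k)//= [X in _ + X]big1 ?addr0 => [|i ik].
    by apply: eq_bigr => j _; rewrite coordE eqxx mulr1.
  by apply: big1 => j _; rewrite coordE eq_sym (negPf ik) mulr0 mul0r.
apply/rowP => k; rewrite sgradE big_split_ord /=.
have [i ->|i ->] := split_ordP k; rewrite ?row_mxEl ?row_mxEr.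
  rewrite [in RHS]mxE !crossvE; congr (_ + _); apply: eq_bigr => j _.
    by rewrite fS block_mxEul mxE.
  by rewrite fR block_mxEur mxE.
rewrite [X in _ + X]big1 => [|j _]; last by rewrite block_mxEdr mxE mul0r.
rewrite addr0 crossvE; apply: eq_bigr => j _.
(* The minus sign and the transpose in the lower left block cancel by antisymmetry of the
   Levi-Civita symbol. *)
rewrite fS block_mxEdl !mxE -sumrN; congr (_ * _); apply: eq_bigr => l _.
by rewrite -mulNr levi_civita_swap opprK.
Qed.

Lemma sgrad_integralK {R : realType} (p : e3dual R) :
  sgrad (@integralK R) p =
    row_mx (crossv (vec3 0 0 1) (Svec p)) (crossv (vec3 0 0 1) (Rvec p)).
Proof.
have K' v : is_derive p v (@integralK R)
    (dot (vec3 0 0 1) (Svec v) + dot 0 (Rvec v)).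
  apply: (is_derive_eq (is_derive_diff v (is_diff_Svec p 2))).
  by rewrite /dot !sum3 !mxE /=; ring.
rewrite (sgrad_crossv K'); congr row_mx.
by apply/rowP; apply: ord3P; rewrite !mxE /=; ring.
Qed.

(* [A] collects the derivatives in the argument [R^2]: it contributes a multiple
   of [R] to the [R]-gradient, hence nothing to [sgrad]. *)
Lemma is_derive_hamiltonian {R : realType} (beta : R) {g1 g2 g3 V : R -> R -> R}
    {p : e3dual R} :
  smooth_coef g1 -> smooth_coef g2 -> smooth_coef g3 -> smooth_coef V ->
  0 < coord_a p ->
  let a := coord_a p in let x := R3 p in
  exists A, forall v, is_derive p v (hamiltonian beta g1 g2 g3 V)
    (dot (vec3 (S1 p + g1 a x * R2 p + g2 a x * R1 p)
               (S2 p - g1 a x * R1 p + g2 a x * R2 p)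
               (S3 p / beta + g2 a x * R3 p + g3 a x)) (Svec v)
   + dot (vec3 (- g1 a x * S2 p + g2 a x * S1 p + 2 * A * R1 p)
               (g1 a x * S1 p + g2 a x * S2 p + 2 * A * R2 p)
               (g2 a x * S3 p + 2 * A * R3 p
                + (dsnd g1 a x * coord_m p + dsnd g2 a x * coord_g p
                   + dsnd g3 a x * coord_k p + dsnd V a x))) (Rvec v)).
Proof.
move=> sm1 sm2 sm3 smV a_gt0 a x.
have [A1 D1] := is_diff_coef sm1 a_gt0.
have [A2 D2] := is_diff_coef sm2 a_gt0.
have [A3 D3] := is_diff_coef sm3 a_gt0.
have [AV DV] := is_diff_coef smV a_gt0.
exists (A1 * coord_m p + A2 * coord_g p + A3 * coord_k p + AV) => v.
have DS i := is_diff_Svec p i; have DR i := is_diff_Rvec p i.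
have Dm := is_diffB (is_diffM (DS 0) (DR 1)) (is_diffM (DS 1) (DR 0)).
have DSR i := is_diffM (DS i) (DR i).
have Dg := is_diffD (is_diffD (DSR 0) (DSR 1)) (DSR 2).
(* The exponent in [is_diffX] is a successor: [1] stands for the square. *)
have DQ := is_diffD (is_diffD (is_diffX 1 (DS 0)) (is_diffX 1 (DS 1)))
                    (is_diffZ beta^-1 (is_diffX 1 (DS 2))).
have D := is_diffD (is_diffD (is_diffD (is_diffD (is_diffZ 2^-1 DQ)
  (is_diffM D1 Dm)) (is_diffM D2 Dg)) (is_diffM D3 (DS 2))) DV.
have {D} := is_derive_diff v D.
set F := (F in is_derive _ _ F _).
have -> : F = hamiltonian beta g1 g2 g3 V.
  apply/funext => q; rewrite /F /hamiltonian /coord_a [dot (Svec q) _]sum3.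
  by rewrite [_ / beta]mulrC.
move/is_derive_eq; apply.
rewrite /x /coord_m /coord_k /coord_g /S1 /S2 /S3 /R1 /R2 /R3 !fctE /dot.
by rewrite !sum3 !vec3E /GRing.scale /=;
   move: (beta^-1) => b; field.
Qed.

(** * Collinearity of the two fields at a point *)

Lemma row_crossv_collinear {R : realType} (h b e s r : 'rV[R]_3) (c : R) :
  row_mx (crossv h s + crossv b r) (crossv h r) =
    c *: row_mx (crossv e s) (crossv e r) <->
  (forall i, crossv h s 0 i + crossv b r 0 i = c * crossv e s 0 i) /\
  (forall i, crossv h r 0 i = c * crossv e r 0 i).
Proof.
rewrite scale_row_mx; split=> [/eq_row_mx[/rowP Es /rowP Er]|[Es Er]].
  split=> i; first by have := Es i; rewrite [LHS]mxE [RHS]mxE.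
  by have := Er i; rewrite [RHS]mxE.
by congr row_mx; apply/rowP => i;
  [rewrite [LHS]mxE [RHS]mxE|rewrite [RHS]mxE].
Qed.

(** The pointwise algebra: [h], [b] are the gradients of [H] at [(s, r)], [w] is the
    [S_3]-derivative, [X] the derivative through the second argument of the coefficients, and
    [sigma / D] is [lambda]. *)
Lemma row_crossv_collinear_axis {R : realType} (s r : 'rV[R]_3)
    (w A X G1 G2 : R) :
  let h := vec3 (s 0 0 + G1 * r 0 1 + G2 * r 0 0)
                (s 0 1 - G1 * r 0 0 + G2 * r 0 1) w in
  let b := vec3 (- G1 * s 0 1 + G2 * s 0 0 + 2 * A * r 0 0)
                (G1 * s 0 0 + G2 * s 0 1 + 2 * A * r 0 1)
                (G2 * s 0 2 + 2 * A * r 0 2 + X) in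
  let D := r 0 0 ^+ 2 + r 0 1 ^+ 2 in
  let sigma := s 0 0 * r 0 0 + s 0 1 * r 0 1 in
  D != 0 ->
  (exists c, row_mx (crossv h s + crossv b r) (crossv h r) =
    c *: row_mx (crossv (vec3 0 0 1) s) (crossv (vec3 0 0 1) r)) <->
  s 0 0 * r 0 1 - s 0 1 * r 0 0 = - D * G1 /\
  r 0 2 * (sigma / D) ^+ 2 - s 0 2 * (sigma / D) + r 0 2 * G1 ^+ 2 + X = 0.
Proof.
move=> h b D sigma D_neq0.
split=> [[{}c /row_crossv_collinear[Es Er]]|[]].
  have := Es 0; have := Es 1; have := Er 0; have := Er 1; have := Er 2.
  rewrite !vec3E => E6 E5 E4 E2 E1.
  have Em : s 0 0 * r 0 1 - s 0 1 * r 0 0 = - D * G1 by rewrite /D; lra.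
  split=> //.
  (* To eliminate [c]: [r_0 E2 - r_1 E1] has right side [c sigma], and [r_0 E5 - r_1 E4] has right
     side [c D]; multiplied by [D] and [sigma] they agree. *)
  have Q0 : r 0 2 * sigma ^+ 2 - s 0 2 * sigma * D
      + D ^+ 2 * (r 0 2 * G1 ^+ 2 + X) = 0.
    have F1 := congr1 ( *%R (D * r 0 1)) E1.
    have F2 := congr1 ( *%R (D * r 0 0)) E2.
    have F4 := congr1 ( *%R (sigma * r 0 1)) E4.
    have F5 := congr1 ( *%R (sigma * r 0 0)) E5.
    have Fm := congr1 ( *%R (D * r 0 2 * G1)) Em.
    by move: F1 F2 F4 F5 Fm; rewrite /D /sigma; lra.
  by apply: (mulfI (expf_neq0 2 D_neq0)); rewrite mulr0 -Q0; field.
have : sigma / D * D = sigma by rewrite divfK.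
move: (sigma / D) => l Dl Em EX; exists (w - r 0 2 * (l + G2)).
(* [Em] and [Dl] form a linear system for [(s_0, s_1)] of determinant [D]; once it is solved, all
   six components are polynomial identities. *)
have Fm0 := congr1 ( *%R (r 0 0)) Em; have Fm1 := congr1 ( *%R (r 0 1)) Em.
have Fl0 := congr1 ( *%R (r 0 0)) Dl; have Fl1 := congr1 ( *%R (r 0 1)) Dl.
have s0E : s 0 0 = l * r 0 0 - G1 * r 0 1.
  by apply: (mulfI D_neq0); move: Fl0 Fm1; rewrite /sigma /D; lra.
have s1E : s 0 1 = l * r 0 1 + G1 * r 0 0.
  by apply: (mulfI D_neq0); move: Fl1 Fm0; rewrite /sigma /D; lra.
have XE : X = s 0 2 * l - r 0 2 * l ^+ 2 - r 0 2 * G1 ^+ 2 by lra.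
apply/row_crossv_collinear; split; apply: ord3P.
all: by rewrite !vec3E ?s0E ?s1E ?XE; ring.
Qed.

(** * Singular points off and on [U] *)

Lemma coord_a_gt0 {R : realType} (p : e3dual R) :
  (0 < coord_a p) = (Rvec p != 0).
Proof.
rewrite /coord_a /dot; under eq_bigr do rewrite -expr2.
have sq_ge0 i : true -> 0 <= Rvec p 0 i ^+ 2 by move=> _; exact: sqr_ge0.
rewrite lt0r sumr_ge0 // andbT psumr_eq0 //; congr (~~ _).
apply/allP/eqP => [R0|-> i _]; last by rewrite mxE expr0n /= eqxx.
apply/rowP => i; rewrite [RHS]mxE; apply/eqP; rewrite -sqrf_eq0.
by have /= -> := R0 i (mem_index_enum i).
Qed.

(** On the axis [R_1 = R_2 = 0 <> R_3] the rank is 0 if [S_1 = S_2 = 0] and 2 otherwise. *)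
Lemma singular_rank1_Udom {R : realType} (beta : R) (g1 g2 g3 V : R -> R -> R)
    (p : e3dual R) :
  smooth_coef g1 -> smooth_coef g2 -> smooth_coef g3 -> smooth_coef V ->
  Rvec p != 0 ->
  singular_rank1 (hamiltonian beta g1 g2 g3 V) (@integralK R) p -> Udom p.
Proof.
move=> sm1 sm2 sm3 smV Rp_neq0 rank1; apply/negP.
rewrite paddr_eq0 ?sqr_ge0 // !sqrf_eq0 => /andP[/eqP R1_0 /eqP R2_0].
have R3_neq0 : R3 p != 0.
  apply: contraNneq Rp_neq0 => R3_0; apply/eqP/rowP.
  by apply: ord3P; rewrite [RHS]mxE.
have a_gt0 : 0 < coord_a p by rewrite coord_a_gt0.
have [A /sgrad_crossv HE] := is_derive_hamiltonian beta sm1 sm2 sm3 smV a_gt0.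
have KE := sgrad_integralK p.
have [S1_0 S2_0] : S1 p = 0 /\ S2 p = 0.
  have [K0|K_neq0] := eqVneq (sgrad (@integralK R) p) 0.
    move: KE; rewrite K0 -row_mx0 => /eq_row_mx[/rowP K0S _].
    by split; [have := K0S 1|have := K0S 0];
       rewrite [LHS]mxE !vec3E /S1 /S2; lra.
  have [c] := (dim_span2_eq1 K_neq0).1 rank1.
  (* On the axis [e3 x R = 0], so the [R]-components read [S_2 R_3 = S_1 R_3 = 0]. *)
  rewrite HE KE => /row_crossv_collinear[_ Er].
  have := Er 0; have := Er 1; rewrite !vec3E -/(R1 p) -/(R2 p) -/(R3 p).
  rewrite R1_0 R2_0 => E1 E0.
  by split; apply: (mulIf R3_neq0); rewrite mul0r; lra.
have K0 : sgrad (@integralK R) p = 0.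
  rewrite KE -row_mx0; congr row_mx; apply/rowP; apply: ord3P;
  rewrite !vec3E [RHS]mxE -/(R1 p) -/(R2 p) -/(S1 p) -/(S2 p);
  by rewrite ?(R1_0, R2_0, S1_0, S2_0); ring.
have H0 : sgrad (hamiltonian beta g1 g2 g3 V) p = 0.
  (* Zero is written as [0 *: sgrad K] to reuse the componentwise criterion with [c = 0]. *)
  rewrite HE -[RHS](scale0r (sgrad (@integralK R) p)) KE.
  apply/row_crossv_collinear; split; apply: ord3P; rewrite !vec3E;
  rewrite -/(R1 p) -/(R2 p) -/(S1 p) -/(S2 p);
  by rewrite !(R1_0, R2_0, S1_0, S2_0) /S3 /R3; ring.
move: rank1; rewrite /singular_rank1 H0 K0 span_cons span_seq1 addvv.
by rewrite dim_vline eqxx.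
Qed.

Lemma singular_rank1_UdomP {R : realType} (beta : R) (g1 g2 g3 V : R -> R -> R)
    (p : e3dual R) :
  smooth_coef g1 -> smooth_coef g2 -> smooth_coef g3 -> smooth_coef V ->
  Rvec p != 0 -> Udom p ->
  singular_rank1 (hamiltonian beta g1 g2 g3 V) (@integralK R) p <->
  let x := coord_x p in let m := coord_m p in let k := coord_k p in
  let a := coord_a p in let g := coord_g p in
  m = - (a - x ^+ 2) * g1 a x /\
  (k * x - g) * (k * a - g * x) / (a - x ^+ 2) ^+ 2
    + x * g1 a x ^+ 2 - (a - x ^+ 2) * g1 a x * dsnd g1 a x
    + g * dsnd g2 a x + k * dsnd g3 a x + dsnd V a x = 0.
Proof.
move=> sm1 sm2 sm3 smV; rewrite -coord_a_gt0 => a_gt0 D_neq0.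
have [A /sgrad_crossv HE] := is_derive_hamiltonian beta sm1 sm2 sm3 smV a_gt0.
have KE := sgrad_integralK p.
have K_neq0 : sgrad (@integralK R) p != 0.
  apply: contraNneq D_neq0 => K0.
  move: KE; rewrite K0 -row_mx0 => /eq_row_mx[_ /rowP K0R].
  have := K0R 0; have := K0R 1; rewrite !vec3E -/(R1 p) -/(R2 p) => E1 E0.
  rewrite mxE in E1; rewrite mxE in E0.
  have R1_0 : R1 p = 0 by lra.
  have R2_0 : R2 p = 0 by lra.
  by rewrite R1_0 R2_0 expr0n addr0.
apply: (iff_trans (dim_span2_eq1 K_neq0)); rewrite HE KE.
apply: (iff_trans (row_crossv_collinear_axis _ _ _ _ _ _ _ D_neq0)) => /=.
have DE : coord_a p - coord_x p ^+ 2 = R1 p ^+ 2 + R2 p ^+ 2.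
  by rewrite /coord_a /coord_x /dot sum3 /R1 /R2 /R3; ring.
rewrite DE.
(* Substituting [m] yields the [g_1 dg_1/dx] term, and [x lambda^2 - k lambda] is the fraction
   because [x (g - k x) - k (a - x^2) = g x - k a]. *)
split=> -[Em EX]; split=> //.
all: rewrite -[RHS]EX (Em : coord_m p = _) /coord_x.
all: move: (g1 _ _) (dsnd g1 _ _) (dsnd g2 _ _) (dsnd g3 _ _) (dsnd V _ _).
all: move=> G1 dG1 dG2 dG3 dV; rewrite /coord_k /coord_g /coord_a /dot !sum3.
all: by rewrite /S3 /R1 /R2 /R3; field.
Qed.

Theorem theorem3 (R : realType) (beta : R) (g1 g2 g3 V : R -> R -> R)
    (beta_gt0 : 0 < beta)
    (g1_smooth : smooth_coef g1) (g2_smooth : smooth_coef g2)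
    (g3_smooth : smooth_coef g3) (V_smooth : smooth_coef V) :
  [set p : e3dual R | Rvec p != 0 /\
     singular_rank1 (hamiltonian beta g1 g2 g3 V) (@integralK R) p]
  =
  [set p : e3dual R | Udom p /\
     let x := coord_x p in let m := coord_m p in let k := coord_k p in
     let a := coord_a p in let g := coord_g p in
     m = - (a - x ^+ 2) * g1 a x /\
     (k * x - g) * (k * a - g * x) / (a - x ^+ 2) ^+ 2
       + x * g1 a x ^+ 2 - (a - x ^+ 2) * g1 a x * dsnd g1 a x
       + g * dsnd g2 a x + k * dsnd g3 a x + dsnd V a x = 0].
Proof.
apply/seteqP; split=> p [].
  move=> R_neq0 rank1; have Up : Udom p by exact: singular_rank1_Udom rank1.
  by split; last exact/(singular_rank1_UdomP beta).
move=> Up eqs.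
have R_neq0 : Rvec p != 0.
  apply: contraNneq Up => R0.
  by rewrite /R1 /R2 R0 !mxE expr0n addr0.
by split; last exact/singular_rank1_UdomP.
Qed.
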